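(* Let $n\ge 3$ and $m\ge 2$ be integers, and let $p_k^{(l)}$ ($k=1,\dots,n$, $l=2,\dots,m$) be real constants satisfying $\sum_{k=1}^n p_k^{(l)}=0$ for all $l=2,\dots,m$. Define $f:\mathbb{R}^n\to\mathbb{R}^n$ by $f(X)=(u_1,\dots,u_n)$, where, for $X=(x_1,\dots,x_n)$, $$u_k(X)=x_k+p_k^{(2)}(x_1+\cdots+x_n)^2+\cdots+p_k^{(m)}(x_1+\cdots+x_n)^m\qquad(k=1,\dots,n).$$ Then $f\in\mathcal{P}_n(m)$.
   Context: $\widehat{\mathcal{P}}_n(m)$ denotes the set of all polynomial mappings $F:\mathbb{R}^n\to\mathbb{R}^n$ of degree less than or equal to $m$ such that $DF(0)=I$ (the identity matrix) and $F(0)=0$, where $DF$ is the Jacobian matrix of $F$. $\mathcal{P}_n(m)=\{F\in\widehat{\mathcal{P}}_n(m): F \text{ is injective}\}$. *)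

(* Defs.v *)
From mathcomp Require Import all_boot all_order all_algebra.
(* Importing [mpoly] after MathComp-Analysis fails: their notations clash. *)
From mathcomp Require Import mpoly.
From mathcomp Require Import all_classical all_reals all_analysis.

Set Implicit Arguments.
Unset Strict Implicit.
Unset Printing Implicit Defensive.

Import numFieldNormedType.Exports.

Local Open Scope classical_set_scope.
Local Open Scope ring_scope.

(* [msize] is 1 + total degree, and 0 for the zero polynomial. *)
Definition polynomial_mapping (R : realType) (n m : nat)
    (F : 'rV[R]_n -> 'rV[R]_n) : Prop :=
  exists P : 'I_n -> {mpoly R[n]},
    (forall k, (msize (P k) <= m.+1)%N) /\
    (forall x k, F x ord0 k = (P k).@[fun i => x ord0 i]).

(* Points of R^n are row vectors, on which [jacobian] acts from the right;
   hence the transpose: entry (i, j) is the derivative of the i-th component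
   of F along the j-th coordinate. *)
Definition jacobian_matrix (R : realType) (n : nat)
    (F : 'rV[R]_n -> 'rV[R]_n) (x : 'rV[R]_n) : 'M[R]_n :=
  (jacobian F x)^T.

Definition polymap_hat (R : realType) (n m : nat) : set ('rV[R]_n -> 'rV[R]_n) :=
  [set F | [/\ polynomial_mapping m F, jacobian_matrix F 0 = 1%:M & F 0 = 0]].
Arguments polymap_hat : clear implicits.

Definition injective_polymap (R : realType) (n m : nat) :
    set ('rV[R]_n -> 'rV[R]_n) :=
  [set F | polymap_hat R n m F /\ injective F].
Arguments injective_polymap : clear implicits.

(* Main.v *)
From HB Require Import structures.
Require Import Defs.
From mathcomp Require Import all_boot all_order all_algebra.
From mathcomp Require Import mpoly.
From mathcomp Require Import all_classical all_reals all_analysis.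

Local Open Scope classical_set_scope.
Local Open Scope ring_scope.

Import GRing.Theory numFieldNormedType.Exports.

(** Write s(X) for the sum of the coordinates of X, a linear form, and let
    g(t) be the vector with components p_k^(2) t^2 + ... + p_k^(m) t^m, so that
    the map is f(X) = X + g(s(X)).  As the coefficients of each degree sum to
    zero, g takes its values in the kernel of s.  Hence f preserves s:
    s(f(X)) = s(X), so that X = f(X) - g(s(f(X))) is recovered from f(X); this
    is [shear_injective].

    As for the normalization at the origin, each summand of the perturbation
    g(s(X)) is a power at least 2 of a form vanishing at 0, times a constant
    vector, so its differential at 0 is zero ([is_diff_exp_vanishing]).  The
    degree bound holds because the l-th power of a polynomial of degree at most
    1 has degree at most l ([msize_exp_le]). *)

(** Since g has values in the kernel of s, the map does not change s, so two
    points with the same image have been translated by the same vector. *)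
Lemma shear_injective (V W : zmodType) (s : {additive V -> W}) (g : W -> V) :
  (forall t, s (g t) = 0) -> injective (fun x => x + g (s x)).
Proof.
move=> sg0 x y fxy; have sxy : s x = s y.
  by have := congr1 s fxy; rewrite !raddfD !sg0 !addr0.
by move: fxy; rewrite sxy => /addIr.
Qed.

(** Degrees are additive over an integral domain; the only strict case is
    q = 0 with l > 0, where the left-hand side is 0 and the right-hand one 1. *)
Lemma msize_exp_le (R : idomainType) (n : nat) (q : {mpoly R[n]}) (l : nat) :
  (msize (q ^+ l) <= ((msize q).-1 * l).+1)%N.
Proof.
have [->|q0] := eqVneq q 0.
  by case: l => [|l]; rewrite ?expr0 ?msize1 // exprS mul0r msize0.
elim: l => [|l IHl]; first by rewrite expr0 msize1.
rewrite exprS msizeM ?expf_neq0 // (mpolySpred _ q0) /= mulnS -addnS.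
by rewrite leq_add2l.
Qed.

Lemma msize_linear_form_le (R : idomainType) (n : nat) :
  (msize (\sum_(i < n) 'X_i : {mpoly R[n]}) <= 2)%N.
Proof.
apply: (leq_trans (mmeasure_sum _ _ _ _)); apply/bigmax_leqP => i _.
by rewrite [X in (X <= _)%N]msizeX mdeg1.
Qed.

(** The differential of s^l at x is l s(x)^(l-1) ds(x), where the exponent
    l - 1 is positive. *)
Lemma is_diff_exp_vanishing (R : numFieldType) (V W : normedModType R)
    (s : V -> R) (x : V) (w : W) (l : nat) :
  differentiable s x -> s x = 0 -> (2 <= l)%N ->
  is_diff x (fun z => s z ^+ l *: w) (cst 0).
Proof.
case: l => [|[|l]] // /differentiableP ds sx0 _.
have dX : is_diff x (fun z => s z ^+ l.+2) (cst 0).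
  have -> : (fun z => s z ^+ l.+2) = s ^+ l.+2.
    by apply/funext => z; rewrite exprfctE.
  apply: (is_diff_eq (is_diffX l.+1 ds)).
  by rewrite sx0 expr0n mulr0 scale0r.
apply: DiffDef; first exact/differentiableZl/ex_diff.
rewrite diffZl ?diff_val; last exact: ex_diff.
by apply/funext => z /=; rewrite scale0r.
Qed.

Lemma is_diff_sum_vanishing (R : numFieldType) (V W : normedModType R)
    (I : eqType) (r : seq I) (g : I -> V -> W) (x : V) :
  (forall i, i \in r -> is_diff x (g i) (cst 0)) ->
  is_diff x (fun z => \sum_(i <- r) g i z) (cst 0).
Proof.
elim: r => [|i r IHr] dg.
  have -> : (fun z => \sum_(j <- [::]) g j z) = cst 0.
    by apply/funext => z; rewrite big_nil.
  exact: is_diff_cst.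
have -> : (fun z => \sum_(j <- i :: r) g j z) =
          g i + (fun z => \sum_(j <- r) g j z).
  by apply/funext => z; rewrite big_cons.
have -> : cst 0 = cst 0 + cst 0 :> (V -> W).
  by apply/funext => z; rewrite /= [RHS]addr0.
apply: is_diffD; first by apply: dg; rewrite mem_head.
by apply: IHr => j jr; apply: dg; rewrite inE jr orbT.
Qed.

Definition coord_sum (R : realType) (n : nat) (X : 'rV[R]_n) : R :=
  \sum_(i < n) X ord0 i.

Lemma coord_sum_is_additive (R : realType) (n : nat) :
  additive (@coord_sum R n).
Proof.
by move=> X Y; rewrite /coord_sum -sumrB; apply: eq_bigr => i _; rewrite !mxE.
Qed.

HB.instance Definition _ (R : realType) (n : nat) :=
  GRing.isAdditive.Build 'rV[R]_n R (@coord_sum R n)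
    (@coord_sum_is_additive R n).

Lemma differentiable_coord_sum (R : realType) (n : nat) (x : 'rV[R]_n) :
  differentiable (@coord_sum R n) x.
Proof.
have -> : @coord_sum R n = \sum_(i < n) (fun X : 'rV[R]_n => X ord0 i).
  by apply/funext => X; rewrite fct_sumE.
by apply: differentiable_sum => i; exact: differentiable_coord.
Qed.

Theorem theorem3 (R : realType) (n m : nat) (hn : (3 <= n)%N) (hm : (2 <= m)%N)
    (p : nat -> 'I_n -> R)
    (hp : forall l : nat, (2 <= l <= m)%N -> \sum_(k < n) p l k = 0) :
  injective_polymap R n m (fun X : 'rV[R]_n =>
    \row_(k < n) (X ord0 k +
      \sum_(2 <= l < m.+1) p l k * (\sum_(i < n) X ord0 i) ^+ l)).
Proof.
pose g (t : R) := \sum_(2 <= l < m.+1) t ^+ l *: \row_(k < n) p l k.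
have -> : (fun X : 'rV[R]_n => \row_(k < n) (X ord0 k +
      \sum_(2 <= l < m.+1) p l k * (\sum_(i < n) X ord0 i) ^+ l)) =
    (fun X => X + g (coord_sum _ _ X)).
  apply/funext => X; apply/rowP => k; rewrite !mxE summxE; congr (_ + _).
  by apply: eq_bigr => l _; rewrite !mxE mulrC.
have s0 : coord_sum R n 0 = 0 by rewrite raddf0.
split; last first.
  apply: shear_injective => t; rewrite raddf_sum big_nat big1 // => l lm.
  rewrite /= /coord_sum.
  under eq_bigr do rewrite !mxE.
  by rewrite -mulr_sumr hp ?mulr0.
split.
- pose P k : {mpoly R[n]} := 'X_k +
    \sum_(2 <= l < m.+1) p l k *: (\sum_(i < n) 'X_i) ^+ l.
  exists P; split=> [k|X k].
    apply: (leq_trans (mmeasureD_le _ _ _)).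
    rewrite geq_max [X in (X <= _)%N]msizeX mdeg1 /= ltnS (ltnW hm) /=.
    apply: (leq_trans (mmeasure_sum _ _ _ _)).
    apply/bigmax_leqP_seq => l; rewrite mem_index_iota => /andP[_ lm] _.
    apply: (leq_trans (msizeZ_le _ _)).
    apply: (leq_trans (msize_exp_le _ _ _ _)).
    (* The base of the power has degree at most 1, so the exponent bounds it. *)
    apply: leq_trans lm; rewrite ltnS -[leqRHS]mul1n leq_mul2r -subn1 leq_subLR.
    by rewrite msize_linear_form_le orbT.
  rewrite !mxE summxE /P mevalD mevalXU raddf_sum /=; congr (_ + _).
  apply: eq_bigr => l _; rewrite !mxE mevalZ rmorphXn /= raddf_sum /= mulrC.
  by congr (_ * _ ^+ _); apply: eq_bigr => i _; rewrite mevalXU.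
- have dF : is_diff (0 : 'rV[R]_n)
      (id + (fun X => g (coord_sum _ _ X))) (id + cst 0).
    apply: is_diffD; apply: is_diff_sum_vanishing => l.
    rewrite mem_index_iota => /andP[l2 _].
    by apply: is_diff_exp_vanishing => //; exact: differentiable_coord_sum.
  apply/matrixP => i j; rewrite /jacobian_matrix /jacobian.
  have -> : 'd (fun X : 'rV[R]_n => X + g (coord_sum R n X)) (0 : 'rV[R]_n)
            = (id + cst 0) :> ('rV[R]_n -> 'rV[R]_n).
    exact: diff_val.
  by rewrite !mxE addr0 eqxx eq_sym.
- rewrite s0 add0r /g big_nat big1 // => l /andP[l2 _].
  by rewrite expr0n; case: l l2 => // l _; rewrite scale0r.
Qed.
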